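(* Let $\{a_n\}_{n\ge1}$ be a decreasing sequence of positive real numbers. Then $\sum a_n$ converges if and only if there exists a sequence $\{q_n\}_{n\ge1}$ of positive real numbers such that $$q_n-2q_{n+1}\geq 2a_{2^{n+1}}$$ for all $n$ sufficiently large. *)

(* Defs.v *)
From Stdlib Require Export Reals.
From Coquelicot Require Export Coquelicot.

(* Main.v *)
Require Import Defs.
From Stdlib Require Import Reals.
From Coquelicot Require Import Coquelicot.
From Stdlib Require Import Lra Lia.
Local Open Scope R_scope.

(** Put [r n = 2 ^ n * q n] and [s m = a 1 + ... + a m].  Multiplying the
    inequality for [q] by [2 ^ n] turns it into
    [r n - r (n + 1) >= 2 ^ (n + 1) * a (2 ^ (n + 1))], so a sequence [q] is a
    positive [r] whose successive drops pay for the terms of the Cauchy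
    condensation of the series.  As [a] decreases, such a condensed term
    bounds a dyadic block of the series from both sides
    ([block_lower], [block_upper]):
    [2 ^ n * a (2 ^ (n + 1)) <= s (2 ^ (n + 1)) - s (2 ^ n)] and
    [s (2 ^ (n + 2)) - s (2 ^ (n + 1)) <= 2 ^ (n + 1) * a (2 ^ (n + 1))].

    If the series converges to [L], the lower bound shows that twice the tail,
    [r n = 2 * (L - s (2 ^ n))], is a suitable choice; it is positive because
    the terms are.  Conversely, given [q], the upper bound shows that
    [s (2 ^ (n + 1)) + r n] is eventually nonincreasing; as [r] is positive,
    the partial sums are bounded, hence convergent. *)

Fixpoint partial_sum (a : nat -> R) (m : nat) : R :=
  match m with
  | O => 0
  | S m' => partial_sum a m' + a m
  end.

Lemma sum_n_partial_sum (a : nat -> R) (m : nat) :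
  sum_n (fun n => a (S n)) m = partial_sum a (S m).
Proof.
induction m as [|m IH].
- rewrite sum_O; simpl; lra.
- rewrite sum_Sn, IH; reflexivity.
Qed.

Lemma decreasing_le (a : nat -> R)
  (a_decr : forall n, (1 <= n)%nat -> a (n + 1)%nat <= a n) (m d : nat) :
  (1 <= m)%nat -> a (m + d)%nat <= a m.
Proof.
intros hm; induction d as [|d IH].
- rewrite Nat.add_0_r; lra.
- assert (H := a_decr (m + d)%nat ltac:(lia)).
  replace (m + S d)%nat with (m + d + 1)%nat by lia; lra.
Qed.

Lemma block_upper (a : nat -> R)
  (a_decr : forall n, (1 <= n)%nat -> a (n + 1)%nat <= a n) (m d : nat) :
  (1 <= m)%nat -> partial_sum a (m + d) - partial_sum a m <= INR d * a m.
Proof.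
intros hm; induction d as [|d IH].
- rewrite Nat.add_0_r; simpl; lra.
- assert (H := decreasing_le a a_decr m (S d) hm).
  rewrite S_INR; rewrite Nat.add_succ_r in *; simpl; lra.
Qed.

(** The last index [m + d] is the one that the induction moves, so it is kept
    as a separate bound [p] on the block. *)
Lemma block_lower (a : nat -> R)
  (a_decr : forall n, (1 <= n)%nat -> a (n + 1)%nat <= a n) (m d p : nat) :
  (m + d <= p)%nat ->
  INR d * a p <= partial_sum a (m + d) - partial_sum a m.
Proof.
induction d as [|d IH]; intros hp.
- rewrite Nat.add_0_r; simpl; lra.
- specialize (IH ltac:(lia)).
  assert (H := decreasing_le a a_decr (S (m + d)) (p - S (m + d)) ltac:(lia)).
  replace (S (m + d) + (p - S (m + d)))%nat with p in H by lia.
  rewrite S_INR, Nat.add_succ_r; simpl; lra.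
Qed.

Lemma partial_sum_lt_S (a : nat -> R)
  (a_pos : forall n, (1 <= n)%nat -> 0 < a n) (m : nat) :
  partial_sum a m < partial_sum a (S m).
Proof. assert (H := a_pos (S m) ltac:(lia)); simpl; lra. Qed.

Lemma partial_sum_le (a : nat -> R)
  (a_pos : forall n, (1 <= n)%nat -> 0 < a n) (m p : nat) :
  (m <= p)%nat -> partial_sum a m <= partial_sum a p.
Proof.
induction 1 as [|p _ IH]; [lra|].
assert (H := partial_sum_lt_S a a_pos p); lra.
Qed.

Lemma partial_sum_lt_series (a : nat -> R) (L : R)
  (a_pos : forall n, (1 <= n)%nat -> 0 < a n) :
  is_series (fun n => a (S n)) L -> forall m, partial_sum a m < L.
Proof.
intros HL m.
assert (Hm : sum_n (fun n => a (S n)) m <= L).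
{ apply (is_lim_seq_incr_compare (sum_n (fun n => a (S n)))); [exact HL|].
  intros n; rewrite !sum_n_partial_sum.
  apply Rlt_le, partial_sum_lt_S, a_pos. }
rewrite sum_n_partial_sum in Hm.
assert (H := partial_sum_lt_S a a_pos m); lra.
Qed.

(** For positive terms it is enough to bound the partial sums along the powers
    of two, since [m < 2 ^ m]. *)
Lemma ex_series_dyadic_bound (a : nat -> R) (M : R) (N : nat)
  (a_pos : forall n, (1 <= n)%nat -> 0 < a n) :
  (forall n, (N <= n)%nat -> partial_sum a (2 ^ n) <= M) ->
  ex_series (fun n => a (S n)).
Proof.
intros HM.
destruct (ex_finite_lim_seq_incr (sum_n (fun n => a (S n))) M) as [L HL].
- intros n; rewrite !sum_n_partial_sum.
  apply Rlt_le, partial_sum_lt_S, a_pos.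
- intros n; rewrite sum_n_partial_sum.
  apply Rle_trans with (partial_sum a (2 ^ (N + S n))); [|apply HM; lia].
  apply partial_sum_le; [exact a_pos|].
  assert (H := Nat.pow_gt_lin_r 2 (N + S n) ltac:(lia)); lia.
- exists L; exact HL.
Qed.

Theorem theorem4p5 (a : nat -> R)
  (a_pos : forall n : nat, (1 <= n)%nat -> 0 < a n)
  (a_decr : forall n : nat, (1 <= n)%nat -> a (n + 1)%nat <= a n) :
  ex_series (fun n : nat => a (S n)) <->
  exists q : nat -> R,
    (forall n : nat, (1 <= n)%nat -> 0 < q n) /\
    eventually (fun n : nat =>
      q n - 2 * q (n + 1)%nat >= 2 * a (2 ^ (n + 1))%nat).
Proof.
assert (pow_pos : forall n, 0 < 2 ^ n) by (intros n; apply pow_lt; lra).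
assert (INR_pow2 : forall n, INR (2 ^ n) = 2 ^ n).
{ intros n; rewrite pow_INR; reflexivity. }
assert (double : forall n, (2 ^ (n + 1) = 2 ^ n + 2 ^ n)%nat).
{ intros n; rewrite Nat.add_1_r; simpl; lia. }
split.
- intros [L HL].
  exists (fun n => 2 * (L - partial_sum a (2 ^ n)) / 2 ^ n); split.
  + intros n _.
    assert (H := partial_sum_lt_series a L a_pos HL (2 ^ n)).
    apply Rdiv_lt_0_compat; [lra | apply pow_pos].
  + exists 0%nat; intros n _.
    assert (H := block_lower a a_decr (2 ^ n) (2 ^ n) (2 ^ (n + 1))
                   ltac:(rewrite double; lia)).
    rewrite <- double, INR_pow2 in H.
    assert (Hp := pow_pos n).
    replace (2 ^ (n + 1)) with (2 * 2 ^ n) by (rewrite Nat.add_1_r; reflexivity).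
    replace (2 * (L - partial_sum a (2 ^ n)) / 2 ^ n -
             2 * (2 * (L - partial_sum a (2 ^ (n + 1))) / (2 * 2 ^ n)))
      with (2 * (partial_sum a (2 ^ (n + 1)) - partial_sum a (2 ^ n)) / 2 ^ n)
      by (field; lra).
    apply Rle_ge, Rmult_le_reg_r with (2 ^ n); [exact Hp|].
    unfold Rdiv; rewrite (Rmult_assoc _ (/ 2 ^ n)), Rinv_l by lra; lra.
- intros [q [q_pos [N HN]]].
  (* Starting at [S N] rather than [N] keeps the index of [q] positive. *)
  assert (Hdesc : forall k,
    partial_sum a (2 ^ (S N + k + 1)) + 2 ^ (S N + k) * q (S N + k)%nat <=
    partial_sum a (2 ^ (S N + 1)) + 2 ^ S N * q (S N)).
  { induction k as [|k IH]; [rewrite Nat.add_0_r; lra|].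
    replace (S N + S k)%nat with (S N + k + 1)%nat by lia.
    set (n := (S N + k)%nat) in *.
    assert (Hq := HN n ltac:(unfold n; lia)).
    assert (H := block_upper a a_decr (2 ^ (n + 1)) (2 ^ (n + 1))
                   ltac:(assert (G := Nat.pow_nonzero 2 (n + 1)); lia)).
    rewrite <- double, INR_pow2 in H.
    assert (Hm := Rmult_le_compat_l (2 ^ n) _ _
                    (Rlt_le _ _ (pow_pos n)) (Rge_le _ _ Hq)).
    replace (2 ^ (n + 1)) with (2 * 2 ^ n) in *
      by (rewrite Nat.add_1_r; reflexivity).
    lra. }
  apply (ex_series_dyadic_bound a
           (partial_sum a (2 ^ (S N + 1)) + 2 ^ S N * q (S N)) (S N + 1) a_pos).
  intros n Hn.
  specialize (Hdesc (n - (S N + 1))%nat).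
  replace (S N + (n - (S N + 1)) + 1)%nat with n in Hdesc by lia.
  assert (Hr := Rmult_lt_0_compat _ _ (pow_pos (S N + (n - (S N + 1)))%nat)
                  (q_pos (S N + (n - (S N + 1)))%nat ltac:(lia))).
  lra.
Qed.
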